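(* Let $s$ be a state, $\mathcal{A}$ the finite action set, $\pi_\beta$ a behavior policy with advantage function $A^{\pi_\beta}$, and $\lambda>0$. Define $$\pi_\beta^*(a\mid s)=\frac{1}{Z_\beta(s)}\,\pi_\beta(a\mid s)\exp\!\left[\tfrac1\lambda A^{\pi_\beta}(s,a)\right],\qquad Z_\beta(s)=\sum_{a\in\mathcal{A}}\pi_\beta(a\mid s)\exp\!\left[\tfrac1\lambda A^{\pi_\beta}(s,a)\right],$$ $$\pi^*(a\mid s)=\frac{1}{Z(s)}\exp\!\left[\tfrac1\lambda A^{\pi_\beta}(s,a)\right],\qquad Z(s)=\sum_{a\in\mathcal{A}}\exp\!\left[\tfrac1\lambda A^{\pi_\beta}(s,a)\right].$$ Then, at the state $s$, $$D_{KL}(\pi^*\,\|\,\pi_\beta^* )\ \ge\ \mathcal{H}(\pi^*,\pi_\beta)-\mathcal{H}(\pi_\beta,\pi^* ).$$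
   Context: A policy $\pi(\cdot\mid s)$ is a probability distribution on the finite action set $\mathcal{A}$ for each state $s$. The advantage function $A^{\pi_\beta}(s,a)=Q^{\pi_\beta}(s,a)-V^{\pi_\beta}(s)$ of the behavior policy $\pi_\beta$ in a Markov decision process is a real-valued function of $(s,a)$. For distributions $p,q$ on $\mathcal{A}$, the cross-entropy is $\mathcal{H}(p,q)=\sum_a p(a)(-\log q(a))$ and $D_{KL}(p\|q)=\sum_a p(a)\log\frac{p(a)}{q(a)}$, with values in $(-\infty,+\infty]$ and the usual conventions $-\log 0=+\infty$, $0\cdot(+\infty)=0$. All quantities are computed at the fixed state $s$. *)

(* Defs.v *)
From mathcomp Require Import all_boot all_order all_algebra.
From mathcomp Require Import all_classical all_reals all_analysis.

Set Implicit Arguments.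
Unset Strict Implicit.
Unset Printing Implicit Defensive.

Import Order.TTheory GRing.Theory Num.Theory.
Local Open Scope ring_scope.

Definition is_distr (R : realType) (A : finType) (p : A -> R) : Prop :=
  (forall a, 0 <= p a) /\ \sum_(a : A) p a = 1.

Record policy (R : realType) (S : Type) (A : finType) := Policy {
  prob :> S -> A -> R ;
  prob_distr : forall s, is_distr (prob s) }.

(* [Q] and [V] send a policy to its action-value and state-value functions.
   They are arbitrary, so that every decision process (any transition law,
   reward, discount or horizon) with real-valued value functions is covered. *)
Definition advantage (R : realType) (S : Type) (A : finType)
    (Q : policy R S A -> S -> A -> R) (V : policy R S A -> S -> R)
    (pi : policy R S A) (s : S) (a : A) : R :=
  Q pi s a - V pi s.

Definition Zbeta (R : realType) (S : Type) (A : finType)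
    (pib : policy R S A) (adv : S -> A -> R) (lam : R) (s : S) : R :=
  \sum_(a : A) pib s a * expR (1 / lam * adv s a).

Definition pib_star (R : realType) (S : Type) (A : finType)
    (pib : policy R S A) (adv : S -> A -> R) (lam : R) (s : S) (a : A) : R :=
  1 / Zbeta pib adv lam s * (pib s a * expR (1 / lam * adv s a)).

Definition Zunif (R : realType) (S : Type) (A : finType)
    (adv : S -> A -> R) (lam : R) (s : S) : R :=
  \sum_(a : A) expR (1 / lam * adv s a).

Definition pi_star (R : realType) (S : Type) (A : finType)
    (adv : S -> A -> R) (lam : R) (s : S) (a : A) : R :=
  1 / Zunif adv lam s * expR (1 / lam * adv s a).

(* In [\bar R], [lne 0 = -oo] and [0 * +oo = 0 * -oo = 0]. *)
Definition cross_entropy (R : realType) (A : finType) (p q : A -> R) : \bar R :=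
  (\sum_(a : A) (p a)%:E * - lne (q a)%:E)%E.

(* The quotient is taken in [\bar R], where [0^-1 = +oo] and [lne +oo = +oo]:
   a term with [p a > 0 = q a] is [+oo], a term with [p a = 0] is [0]. *)
Definition KL (R : realType) (A : finType) (p q : A -> R) : \bar R :=
  (\sum_(a : A) (p a)%:E * lne ((p a)%:E / (q a)%:E))%E.

Lemma Zbeta_gt0 (R : realType) (S : Type) (A : finType)
    (pib : policy R S A) (adv : S -> A -> R) (lam : R) (s : S) :
  0 < Zbeta pib adv lam s.
Proof.
have [p0 p1] := prob_distr pib s.
have t0 a : true -> 0 <= pib s a * expR (1 / lam * adv s a).
  by move=> _; rewrite mulr_ge0 ?expR_ge0.
rewrite lt_neqAle sumr_ge0 // andbT eq_sym psumr_eq0 //.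
apply/negP => /allP z; move: p1; rewrite big1 => [/eqP|a _].
  by rewrite eq_sym oner_eq0.
have := z a (mem_index_enum a).
by rewrite /= mulf_eq0 [expR _ == 0]gt_eqF ?expR_gt0 // orbF => /eqP.
Qed.

Lemma Zunif_gt0 (R : realType) (S : Type) (A : finType)
    (pib : policy R S A) (adv : S -> A -> R) (lam : R) (s : S) :
  0 < Zunif adv lam s.
Proof.
apply: lt_le_trans (Zbeta_gt0 pib adv lam s) _.
have [p0 p1] := prob_distr pib s.
apply: ler_sum => a _; rewrite ler_piMl ?expR_ge0 //.
by rewrite -p1 (bigD1 a) //= lerDl sumr_ge0.
Qed.

Lemma pib_star_distr (R : realType) (S : Type) (A : finType)
    (pib : policy R S A) (adv : S -> A -> R) (lam : R) (s : S) :
  is_distr (pib_star pib adv lam s).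
Proof.
have Z0 := Zbeta_gt0 pib adv lam s; have [p0 _] := prob_distr pib s.
split=> [a|]; last by rewrite -mulr_sumr div1r mulVf ?gt_eqF.
by rewrite /pib_star div1r mulr_ge0 ?invr_ge0 ?(ltW Z0) // mulr_ge0 ?expR_ge0.
Qed.

(* A policy is needed only to ensure that [A] is nonempty. *)
Lemma pi_star_distr (R : realType) (S : Type) (A : finType)
    (pib : policy R S A) (adv : S -> A -> R) (lam : R) (s : S) :
  is_distr (pi_star adv lam s).
Proof.
have Z0 := Zunif_gt0 pib adv lam s.
split=> [a|]; last by rewrite -mulr_sumr div1r mulVf ?gt_eqF.
by rewrite /pi_star div1r mulr_ge0 ?invr_ge0 ?(ltW Z0) ?expR_ge0.
Qed.

(* Main.v *)
Require Import Defs.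
From mathcomp Require Import all_boot all_order all_algebra.
From mathcomp Require Import all_classical all_reals all_analysis.
From mathcomp Require Import ring lra.

(** In [KL pi_star pib_star] the exponentials cancel: if [pib] has full support
    it equals [H(pi_star, pib) + ln Zbeta - ln Z], while
    [H(pib, pi_star) = ln Z - m] with [m] the [pib]-mean of [A / lam].  The
    inequality is thus Jensen's [m <= ln Zbeta].  If [pib] vanishes at some
    action, the divergence is [+oo]. *)

Set Implicit Arguments.
Unset Strict Implicit.
Unset Printing Implicit Defensive.

Import Order.TTheory GRing.Theory Num.Theory.
Local Open Scope ring_scope.

Lemma cross_entropy_EFin (R : realType) (A : finType) (p q : A -> R) :
  (forall a, 0 < q a) ->
  cross_entropy p q = (\sum_(a : A) p a * - ln (q a))%:E.
Proof.
by move=> q0; rewrite -sumEFin; apply: eq_bigr => a _; rewrite lne_EFin.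
Qed.

Lemma KL_EFin (R : realType) (A : finType) (p q : A -> R) :
  (forall a, 0 < p a) -> (forall a, 0 < q a) ->
  KL p q = (\sum_(a : A) p a * (ln (p a) - ln (q a)))%:E.
Proof.
move=> p0 q0; rewrite -sumEFin; apply: eq_bigr => a _.
by rewrite inver gt_eqF // -EFinM lne_EFin ?divr_gt0 // -EFinM ln_div // posrE.
Qed.

(** The term at [b] is infinite because [p b] is positive. Every other term is real or [+oo], so no
    [-oo] can absorb it in the extended sum. *)
Lemma KL_eq_pinfty (R : realType) (A : finType) (p q : A -> R) (b : A) :
  (forall a, 0 < p a) -> (forall a, 0 <= q a) -> q b = 0 ->
  KL p q = +oo%E.
Proof.
move=> p0 q0 qb0.
have term a : ((p a)%:E * lne ((p a)%:E / (q a)%:E))%E =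
    if q a == 0 then +oo%E else (p a * ln (p a / q a))%:E.
  rewrite inver; case: ifPn => [_|qa0]; first by rewrite !gt0_muley ?lte_fin.
  by rewrite -EFinM lne_EFin // divr_gt0 // lt_neqAle eq_sym qa0 q0.
apply/esum_eqyP => [a _|]; first by rewrite term; case: ifP.
by exists b; rewrite term qb0 eqxx mem_index_enum.
Qed.

Lemma le_mean_ln_sum_expR (R : realType) (A : finType) (p x : A -> R) :
  is_distr p -> 0 < \sum_(a : A) p a * expR (x a) ->
  \sum_(a : A) p a * x a <= ln (\sum_(a : A) p a * expR (x a)).
Proof.
move=> [p0 p1] Z0; set m := (X in X <= _).
(* Writing [m] as [ln (expR m)] and using that [ln] is increasing leaves Jensen's inequality for
   [expR]. *)
rewrite -[m]expRK ler_ln ?posrE ?expR_gt0 //.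
(* Average the tangent line bound of [expR] at [m]. *)
have -> : expR m = \sum_(a : A) p a * (expR m * (1 + (x a - m))).
  transitivity (expR m * (\sum_(a : A) p a + \sum_(a : A) p a * x a
                          - \sum_(a : A) p a * m)).
    by rewrite -mulr_suml p1 -/m; ring.
  rewrite -big_split -sumrB mulr_sumr; apply: eq_bigr => a _ /=; ring.
apply: ler_sum => a _; apply: ler_wpM2l => //.
(* The bound [1 + t <= expR t] at [t = x a - m], scaled by [expR m]. *)
rewrite -[x a in leRHS](subrKC m) expRD.
by rewrite ler_wpM2l ?expR_ge0 // expR_ge1Dx.
Qed.

Theorem theorem1 (R : realType) (S : Type) (A : finType)
    (Q : policy R S A -> S -> A -> R) (V : policy R S A -> S -> R)
    (pib : policy R S A) (lam : R) (hlam : 0 < lam) (s : S) :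
  (cross_entropy (pi_star (advantage Q V pib) lam s) (pib s)
     - cross_entropy (pib s) (pi_star (advantage Q V pib) lam s)
   <= KL (pi_star (advantage Q V pib) lam s)
         (pib_star pib (advantage Q V pib) lam s))%E.
Proof.
set adv := advantage Q V pib.
have pib_distr := prob_distr pib s; have [pib0 pib1] := pib_distr.
have Zb0 := Zbeta_gt0 pib adv lam s.
have Z0 := Zunif_gt0 pib adv lam s.
have [_ pi1] := pi_star_distr pib adv lam s.
have [pibs0 _] := pib_star_distr pib adv lam s.
have pi0 a : 0 < pi_star adv lam s a.
  by rewrite /pi_star div1r mulr_gt0 ?invr_gt0 ?expR_gt0.
(* A zero of [pib] is a zero of [pib_star], whereas [pi_star] is positive everywhere; the right-hand
   side is then [+oo]. *)
have [/existsP[b /eqP pibb0]|/existsPn pib_neq0] :=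
    boolP [exists a, pib s a == 0].
  by rewrite (KL_eq_pinfty (b := b)) ?leey // /pib_star pibb0 mul0r mulr0.
have {pib_neq0}pib_gt0 a : 0 < pib s a by rewrite lt_neqAle eq_sym pib_neq0 pib0.
have pibs_gt0 a : 0 < pib_star pib adv lam s a.
  by rewrite /pib_star div1r mulr_gt0 ?invr_gt0 // mulr_gt0 ?expR_gt0.
(* With full support every logarithm is finite, so the claim becomes one about reals. *)
rewrite !cross_entropy_EFin // KL_EFin // -EFinB lee_fin.
have ln_pi a : ln (pi_star adv lam s a)
    = 1 / lam * adv s a - ln (Zunif adv lam s).
  by rewrite /pi_star div1r lnM ?posrE ?invr_gt0 ?expR_gt0 // lnV // expRK addrC.
have ln_pibs a : ln (pib_star pib adv lam s a)
    = ln (pib s a) + 1 / lam * adv s a - ln (Zbeta pib adv lam s).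
  rewrite /pib_star div1r lnM ?posrE ?invr_gt0 ?mulr_gt0 ?expR_gt0 //.
  by rewrite lnV // lnM ?posrE ?expR_gt0 // expRK addrC.
have -> : \sum_a pib s a * - ln (pi_star adv lam s a)
    = ln (Zunif adv lam s) - \sum_a pib s a * (1 / lam * adv s a).
  rewrite -[X in X - _]mul1r -{1}pib1 mulr_suml -sumrB.
  by apply: eq_bigr => a _; rewrite ln_pi; ring.
(* The terms [1 / lam * adv s a] cancel; the remaining constant is spread over the sum through the
   total mass [pi1]. *)
have -> : \sum_a pi_star adv lam s a
      * (ln (pi_star adv lam s a) - ln (pib_star pib adv lam s a))
    = \sum_a pi_star adv lam s a * - ln (pib s a)
      + (ln (Zbeta pib adv lam s) - ln (Zunif adv lam s)).
  rewrite -[X in _ + X]mul1r -pi1 mulr_suml -big_split.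
  by apply: eq_bigr => a _; rewrite /= ln_pi ln_pibs; ring.
(* The cross-entropy of [pi_star] against [pib] and [ln Z] occur on both sides and drop out. *)
have := le_mean_ln_sum_expR pib_distr Zb0.
rewrite -/(Zbeta pib adv lam s); lra.
Qed.
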